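(* Consider the random process defined by $x(t+1)=x(t)-L(t)x(t)$, $t\in\mathbb{Z}_{\ge0}$, with deterministic initial condition $x(0)\in\mathbb{R}^I$. Assume that $\mathbf{1}^*\mathbb{E}[L(t)]=0$ and that there exists $\gamma>0$ such that $$\mathbb{E}[L(t)^*\mathbf{1}\mathbf{1}^*L(t)]\le \gamma\,\mathbb{E}[L(t)+L(t)^*-L(t)^*L(t)].$$ Then for every $t\ge 0$, $$\mathbb{E}\big[(\bar x(t)-\bar x(0))^2\big]\le \frac{\gamma}{N+\gamma}\,V(x(0)).$$ Moreover, if the system converges to consensus almost surely, i.e. $x(t)\to x_\infty\mathbf{1}$ for some random scalar $x_\infty\in\mathbb{R}$, then $\mathbb{E}[(x_\infty-\bar x(0))^2]\le \frac{\gamma}{N+\gamma}V(x(0))$.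
   Context: Let $I$ be a finite set of $N$ nodes. For each $t\in\mathbb{Z}_{\ge0}$ let $A(t)=(a_{ij}(t))_{i,j\in I}$ be a random matrix with $a_{ij}(t)\ge 0$ and $\sum_{\ell\in I}a_{i\ell}(t)=1$ for all $i$; the matrices $A(t)$, $t\ge0$, are independent and identically distributed (in particular $A(t)$ is independent of $x(t)$). Let $L(t)$ be the associated Laplacian: $L_{ij}(t)=-a_{ij}(t)$ for $i\ne j$ and $L_{ii}(t)=\sum_{j\ne i}a_{ij}(t)$. $\mathbf{1}$ is the all-ones vector, $M^*$ denotes the (conjugate) transpose. For $y\in\mathbb{R}^I$, $\bar y=\frac1N\sum_i y_i$ and $V(y)=\frac1N\sum_i(y_i-\bar y)^2$. For square matrices, $A\le B$ means $A-B$ is negative semidefinite. *)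

(* Defs.v *)
From HB Require Import structures.
From mathcomp Require Import all_boot all_order all_algebra.
From mathcomp Require Import all_classical all_reals all_analysis.
Set Implicit Arguments. Unset Strict Implicit. Unset Printing Implicit Defensive.
Import Order.TTheory GRing.Theory Num.Theory.
Local Open Scope classical_set_scope.
Local Open Scope ring_scope.

Section Defs.
Context {R : realType} {N : nat}.

Definition lap (A : 'M[R]_N) : 'M[R]_N :=
  \matrix_(i, j) (if i == j then \sum_(k | k != i) A i k else - A i j).

Definition row_stochastic (A : 'M[R]_N) : Prop :=
  (forall i j, 0 <= A i j) /\ (forall i, \sum_(l < N) A i l = 1).

Definition avg (y : 'cV[R]_N) : R := (\sum_(i < N) y i 0) / N%:R.
Definition Var (y : 'cV[R]_N) : R :=
  (\sum_(i < N) (y i 0 - avg y) ^+ 2) / N%:R.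

Definition mx_meas : set (set 'M[R]_N) :=
  <<s [set S | exists (i j : 'I_N) (B : set R),
                 measurable B /\ S = [set M : 'M[R]_N | B (M i j)]] >>.

(* negative semidefiniteness, as in "A <= B iff A - B is NSD" *)
Definition nsd (M : 'M[R]_N) : Prop :=
  forall v : 'cV[R]_N, (v^T *m M *m v) 0 0 <= 0.

Context {d : measure_display} {T : measurableType d}.

Fixpoint proc (A : nat -> T -> 'M[R]_N) (x0 : 'cV[R]_N) (t : nat) (w : T)
  : 'cV[R]_N :=
  match t with
  | 0 => x0
  | t'.+1 => proc A x0 t' w - lap (A t' w) *m proc A x0 t' w
  end.

Variable P : probability T R.

Definition Emx (F : T -> 'M[R]_N) : 'M[R]_N :=
  \matrix_(i, j) fine (\int[P]_w (F w i j)%:E)%E.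

Definition random_matrix (F : T -> 'M[R]_N) : Prop :=
  forall B, mx_meas B -> measurable (F @^-1` B).

Definition mutually_independent (A : nat -> T -> 'M[R]_N) : Prop :=
  forall (S : seq nat), uniq S ->
  forall B : nat -> set 'M[R]_N, (forall s, mx_meas (B s)) ->
  P (\bigcap_(s in [set` S]) (A s @^-1` B s)) =
  (\prod_(s <- S) P (A s @^-1` B s))%E.

Definition identically_distributed (A : nat -> T -> 'M[R]_N) : Prop :=
  forall t B, mx_meas B -> P (A t @^-1` B) = P (A 0%N @^-1` B).

End Defs.

(* Main.v *)
Require Import Defs.
From HB Require Import structures.
From mathcomp Require Import all_boot all_order all_algebra.
From mathcomp Require Import all_classical all_reals all_analysis.
From mathcomp Require Import measurable_realfun ring lra.
Import Order.TTheory GRing.Theory Num.Theory numFieldNormedType.Exports.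
Local Open Scope classical_set_scope.
Local Open Scope ring_scope.

(** Since each [A t] is row stochastic, [lap (A t) = 1 - A t] and the process is
    [x (t+1) = A t * x t].  For [E y = (1^T y)^2 + gamma |y|^2], the two hypotheses on
    the Laplacian say exactly that the mean of [E (A t * v)] is at most [E v] for every
    fixed [v], and that the mean of [1^T A t v] is [1^T v].  As [A t] is independent
    of [x t], the mean of [E (x t)] is nonincreasing and the mean of [avg (x t)] is
    constant.  Writing [E y = N ((N + gamma) (avg y)^2 + gamma Var y)] and dropping
    [Var (x t) >= 0] gives the bound; the limit case is dominated convergence, the
    process being bounded. *)

(** * Expectation of bounded measurable functions *)

Section BoundedExpectation.
Context {R : realType} {d : measure_display} {T : measurableType d}.
Context (P : probability T R).

(** A class closed under sums, products and powers whose members are all integrable for [P]; every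
    random quantity at a fixed time lies in it, so integrability never has to be argued
    separately. *)
Definition bdd_mfun (f : T -> R) : Prop :=
  measurable_fun setT f /\ exists C : R, forall w, `|f w| <= C.

Lemma bdd_mfun_cst (c : R) : bdd_mfun (fun=> c).
Proof. by split; [exact: measurable_cst | exists `|c|]. Qed.

Lemma bdd_mfunD (f g : T -> R) :
  bdd_mfun f -> bdd_mfun g -> bdd_mfun (fun w => f w + g w).
Proof.
move=> [mf [C fC]] [mg [D gD]]; split; first exact: measurable_funD.
by exists (C + D) => w; apply: le_trans (ler_normD _ _) _; apply: lerD.
Qed.

Lemma bdd_mfunM (f g : T -> R) :
  bdd_mfun f -> bdd_mfun g -> bdd_mfun (fun w => f w * g w).
Proof.
move=> [mf [C fC]] [mg [D gD]]; split; first exact: measurable_funM.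
by exists (C * D) => w; rewrite normrM; apply: ler_pM.
Qed.

Lemma bdd_mfunB (f g : T -> R) :
  bdd_mfun f -> bdd_mfun g -> bdd_mfun (fun w => f w - g w).
Proof.
move=> bf bg.
have -> : (fun w => f w - g w) = (fun w => f w + (-1) * g w).
  by apply/funext => w; rewrite mulN1r.
by apply: bdd_mfunD => //; apply: bdd_mfunM => //; exact: bdd_mfun_cst.
Qed.

Lemma bdd_mfun_sum (I : Type) (s : seq I) (f : I -> T -> R) :
  (forall i, bdd_mfun (f i)) -> bdd_mfun (fun w => \sum_(i <- s) f i w).
Proof.
move=> bf; elim: s => [|i s IH].
  by under eq_fun do rewrite big_nil; exact: bdd_mfun_cst.
by under eq_fun do rewrite big_cons; exact: bdd_mfunD.
Qed.

Lemma bdd_mfun_prod (I : Type) (s : seq I) (f : I -> T -> R) :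
  (forall i, bdd_mfun (f i)) -> bdd_mfun (fun w => \prod_(i <- s) f i w).
Proof.
move=> bf; elim: s => [|i s IH].
  by under eq_fun do rewrite big_nil; exact: bdd_mfun_cst.
by under eq_fun do rewrite big_cons; exact: bdd_mfunM.
Qed.

Lemma bdd_mfunX (f : T -> R) n : bdd_mfun f -> bdd_mfun (fun w => f w ^+ n).
Proof.
move=> bf; elim: n => [|n IH].
  by under eq_fun do rewrite expr0; exact: bdd_mfun_cst.
by under eq_fun do rewrite exprS; exact: bdd_mfunM.
Qed.

Lemma bdd_mfun_indic (B : set T) : measurable B -> bdd_mfun (\1_B : T -> R).
Proof.
move=> mB; split; first exact: measurable_indic.
by exists 1 => w; rewrite indicE; case: (_ \in _); rewrite ?normr0 ?normr1.
Qed.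

Lemma bdd_mfun_integrable (f : T -> R) :
  bdd_mfun f -> P.-integrable setT (EFin \o f).
Proof.
move=> [mf [C fC]]; apply: measurable_bounded_integrable => //.
  by rewrite [ltLHS]probability_setT ltry.
exists C; split; first exact: num_real.
by move=> y /ltW Cy w _; exact: le_trans (fC w) Cy.
Qed.

(** Real-valued, so that [ring] and [lra] apply; [ExE] leads back to the extended-real integral. *)
Definition Ex (f : T -> R) : R := \int[P]_w f w.

Lemma ExE (f : T -> R) : bdd_mfun f -> (\int[P]_w (f w)%:E = (Ex f)%:E)%E.
Proof.
move=> bf; rewrite /Ex /Rintegral fineK//.
by apply: integrable_fin_num => //; exact: bdd_mfun_integrable.
Qed.

Lemma eq_Ex (f g : T -> R) : f =1 g -> Ex f = Ex g.
Proof. by move=> fg; congr Ex; apply/funext. Qed.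

Lemma Ex_cst (c : R) : Ex (fun=> c) = c.
Proof. by rewrite /Ex Rintegral_cst// [X in fine X]probability_setT mulr1. Qed.

Lemma ExD (f g : T -> R) : bdd_mfun f -> bdd_mfun g ->
  Ex (fun w => f w + g w) = Ex f + Ex g.
Proof. by move=> bf bg; rewrite /Ex RintegralD//; exact: bdd_mfun_integrable. Qed.

Lemma ExB (f g : T -> R) : bdd_mfun f -> bdd_mfun g ->
  Ex (fun w => f w - g w) = Ex f - Ex g.
Proof. by move=> bf bg; rewrite /Ex RintegralB//; exact: bdd_mfun_integrable. Qed.

Lemma ExZ (c : R) (f : T -> R) : bdd_mfun f -> Ex (fun w => c * f w) = c * Ex f.
Proof. by move=> bf; rewrite /Ex RintegralZl//; exact: bdd_mfun_integrable. Qed.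

Lemma Ex_sum (I : Type) (s : seq I) (f : I -> T -> R) :
  (forall i, bdd_mfun (f i)) ->
  Ex (fun w => \sum_(i <- s) f i w) = \sum_(i <- s) Ex (f i).
Proof.
move=> bf; elim: s => [|i s IH].
  by under eq_Ex do rewrite big_nil; rewrite Ex_cst big_nil.
under eq_Ex do rewrite big_cons; rewrite big_cons ExD ?IH//.
exact: bdd_mfun_sum.
Qed.

Lemma le_Ex (f g : T -> R) : bdd_mfun f -> bdd_mfun g ->
  (forall w, f w <= g w) -> Ex f <= Ex g.
Proof.
by move=> bf bg fg; apply: le_Rintegral => // *; exact: bdd_mfun_integrable.
Qed.

Lemma Ex_norm_le (f : T -> R) (c : R) : bdd_mfun f ->
  (forall w, `|f w| <= c) -> `|Ex f| <= c.
Proof.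
move=> bf fc; rewrite ler_norml -(Ex_cst c) -mulN1r -ExZ; last exact: bdd_mfun_cst.
rewrite !le_Ex//; try exact: bdd_mfun_cst.
  by move=> w; have := fc w; rewrite ler_norml => /andP[].
by move=> w; rewrite mulN1r; have := fc w; rewrite ler_norml => /andP[].
Qed.

Lemma Ex_indic (B : set T) : measurable B -> Ex (\1_B) = fine (P B).
Proof. by move=> mB; rewrite /Ex /Rintegral integral_indic// setIT. Qed.

(** The sum counts the integers between 1 and [n] that are at most [y], so it is the floor of
    [y]. *)
Lemma floor_layer_cake (y : R) n : 0 <= y <= n%:R ->
  y - 1 <= \sum_(k < n) (if k.+1%:R <= y then 1 else 0) <= y.
Proof.
elim: n => [|n IH]; first by rewrite big_ord0; lra.
rewrite big_ord_recr /= -natr1; set s := \sum_(_ < _) _ in IH * => yn.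
(* If [y < n], the new term is 0 and the induction hypothesis suffices; otherwise all [n] earlier
   terms equal 1. *)
have [ny|yn'] := leP n%:R y; last by case: ifP => h; lra.
suff -> : s = n%:R by case: ifP => h; lra.
rewrite /s; transitivity (\sum_(k < n) (1 : R)).
  apply: eq_bigr => k _; rewrite ifT//; apply: le_trans ny.
  by rewrite ler_nat.
by rewrite sumr_const card_ord.
Qed.

(* [h] is within [1/n] of [n^-1 * \sum_(k < n) 1{k.+1 / n <= h}], a combination
   of the indicators covered by the hypothesis. *)
Lemma Ex_mul_superlevel (g h : T -> R) : bdd_mfun g -> measurable_fun setT h ->
  (forall w, 0 <= h w <= 1) ->
  (forall c, Ex (fun w => g w * \1_[set w | c <= h w] w) =
             Ex g * Ex (\1_[set w | c <= h w])) ->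
  Ex (fun w => g w * h w) = Ex g * Ex h.
Proof.
move=> bg mh h01 H.
have bh : bdd_mfun h.
  by split=> //; exists 1 => w; have /andP[? ?] := h01 w; rewrite ger0_norm.
have bi c : bdd_mfun (\1_[set w | c <= h w]).
  apply: bdd_mfun_indic; rewrite -[X in measurable X]setTI.
  have -> : [set w | c <= h w] = h @^-1` `[c, +oo[.
    by apply/seteqP; split=> w /=; rewrite in_itv /= andbT.
  exact: mh.
have [C gC] := bg.2.
have C0 : 0 <= C by apply: le_trans (gC point).
pose a n w := n.+1%:R^-1 * \sum_(k < n.+1) (\1_[set w | k.+1%:R / n.+1%:R <= h w] w : R).
have ba n : bdd_mfun (a n).
  by apply: bdd_mfunM (bdd_mfun_cst _) _; exact: bdd_mfun_sum.
have ah n w : `|h w - a n w| <= n.+1%:R^-1.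
  have n0 : 0 < n.+1%:R :> R by rewrite ltr0n.
  have /andP[h0 h1] := h01 w.
  have : 0 <= n.+1%:R * h w <= n.+1%:R.
    by rewrite mulr_ge0//= -[leRHS]mulr1 ler_pM2l.
  move=> /floor_layer_cake; set s := \sum_(_ < _) _.
  have -> : a n w = n.+1%:R^-1 * s.
    rewrite /a; congr (_ * _); apply: eq_bigr => k _.
    rewrite indicE; case: ifPn => hk.
      by rewrite mem_set//= ler_pdivrMr// mulrC.
    by rewrite memNset//=; apply/negP; rewrite ler_pdivrMr// mulrC.
  move=> sb; rewrite -(ler_pM2l n0) divff ?gt_eqF//.
  rewrite -{1}(gtr0_norm n0) -normrM mulrBr mulrA divff ?gt_eqF// mul1r ler_norml.
  by lra.
have aE n : Ex (fun w => g w * a n w) = Ex g * Ex (a n).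
  rewrite (eq_Ex _ (fun w => n.+1%:R^-1 * \sum_(k < n.+1)
     (g w * \1_[set w | k.+1%:R / n.+1%:R <= h w] w))); last first.
    by move=> w; rewrite /a mulrCA mulr_sumr.
  rewrite ExZ; last by apply: bdd_mfun_sum => k; exact: bdd_mfunM.
  rewrite Ex_sum; last by move=> k; exact: bdd_mfunM.
  rewrite /a ExZ; last exact: bdd_mfun_sum.
  rewrite Ex_sum//.
  rewrite [RHS]mulrCA; congr (_ * _); rewrite mulr_sumr.
  by apply: eq_bigr => k _; exact: H.
apply/eqP; rewrite -subr_eq0 -normr_le0; apply/ler_addgt0Pl => e e0.
rewrite addr0.
(* Replacing [h] by [a n] costs at most [C / n.+1] on each side of the identity, hence [C + C] over
   [e]. *)
have [n nP] : exists n : nat, (C + C) / e < n.+1%:R.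
  exists (Num.truncn ((C + C) / e)); exact: truncnS_gt.
(* By [aE] the identity is exact for [a n], so only the error [h - a n] remains. *)
have -> : Ex (fun w => g w * h w) - Ex g * Ex h =
    Ex (fun w => g w * (h w - a n w)) - Ex g * Ex (fun w => h w - a n w).
  rewrite ExB// mulrBr -aE.
  rewrite (eq_Ex (fun w => g w * (h w - a n w)) (fun w => g w * h w - g w * a n w)).
    rewrite ExB//; first by ring.
    by apply: bdd_mfunM.
    by apply: bdd_mfunM.
  by move=> w; rewrite mulrBr.
apply: le_trans (ler_normB _ _) _.
apply: (@le_trans _ _ (C / n.+1%:R + C / n.+1%:R)).
  apply: lerD.
    apply: Ex_norm_le; first by apply: bdd_mfunM => //; exact: bdd_mfunB.
    by move=> w; rewrite normrM; apply: ler_pM.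
  rewrite normrM; apply: ler_pM => //; first exact: Ex_norm_le.
  by apply: Ex_norm_le => //; exact: bdd_mfunB.
rewrite -mulrDl ler_pdivrMr ?ltr0n// mulrC -ler_pdivrMr//; exact: ltW.
Qed.

End BoundedExpectation.

(** * Measurable functions of a matrix, and stochastic matrices *)

Section MatrixFunctions.
Context {R : realType} {N : nat}.

Definition mx_mfun (m : 'M[R]_N -> R) : Prop :=
  forall Y : set R, measurable Y -> mx_meas (m @^-1` Y).

Lemma mx_mfun_entry i j : mx_mfun (fun M => M i j).
Proof. by move=> Y mY; apply: sub_sigma_algebra; exists i, j, Y. Qed.

Lemma mx_mfunM m1 m2 :
  mx_mfun m1 -> mx_mfun m2 -> mx_mfun (fun M => m1 M * m2 M).
Proof.
(* [G] is the family generating [mx_meas]; over the measurable type it generates, [mx_mfun] is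
   ordinary measurability and the general product lemma applies. *)
pose G : set (set 'M[R]_N) := [set S | exists (i j : 'I_N) (B : set R),
  measurable B /\ S = [set M : 'M[R]_N | B (M i j)]].
have E (m : 'M[R]_N -> R) :
    mx_mfun m <-> measurable_fun setT (m : g_sigma_algebraType G -> R).
  split=> [mm _ Y mY|mm Y mY]; first by rewrite setTI; exact: mm.
  by have := mm measurableT Y mY; rewrite setTI.
by move=> /E m1m /E m2m; apply/E; exact: measurable_funM.
Qed.

Lemma row_stochastic_entry (M : 'M[R]_N) i j :
  row_stochastic M -> 0 <= M i j <= 1.
Proof.
move=> [M0 M1]; rewrite M0/= -(M1 i) (bigD1 j)//= lerDl.
by apply: sumr_ge0.
Qed.

Lemma lap_row_stochastic (M : 'M[R]_N) : row_stochastic M -> lap M = 1%:M - M.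
Proof.
move=> [_ M1]; apply/matrixP => i j; rewrite !mxE.
case: eqVneq => [<-|ij]; last by rewrite sub0r.
by apply/eqP; rewrite eq_sym subr_eq -(M1 i) (bigD1 i)//= addrC.
Qed.

End MatrixFunctions.

(** * Independence of the past from the present and future matrices *)

Section Independence.
Context {R : realType} {N : nat} {d : measure_display} {T : measurableType d}.
Context (P : probability T R) (A : nat -> T -> 'M[R]_N).
Context (mA : forall t, random_matrix (A t)).
Context (AI : mutually_independent P A).

(** Expresses that [g] is independent of the family of all [A s] with [t <= s], tested on finitely
    many events, without introducing the sigma-algebra of the past. *)
Definition indep_future (t : nat) (g : T -> R) : Prop :=
  forall (S : seq nat) (B : nat -> set 'M[R]_N),
  uniq S -> (forall s, s \in S -> (t <= s)%N) -> (forall s, mx_meas (B s)) ->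
  Ex P (fun w => g w * \prod_(s <- S) \1_(A s @^-1` B s) w) =
  Ex P g * \prod_(s <- S) fine (P (A s @^-1` B s)).

Let bdd_indic s B : mx_meas B -> bdd_mfun (\1_(A s @^-1` B) : T -> R).
Proof. by move=> mB; apply: bdd_mfun_indic; exact: mA. Qed.

(** Mutual independence in expectation form: the product of the indicators is the indicator of the
    intersection. *)
Lemma indep_future_cst t c : indep_future t (fun=> c).
Proof.
move=> S B uS _ mB; have mAB s : measurable (A s @^-1` B s) by exact: mA.
rewrite ExZ; last by apply: bdd_mfun_prod => s; exact: bdd_mfun_indic.
rewrite Ex_cst; congr (_ * _).
transitivity (Ex P (\1_(\bigcap_(s in [set` S]) (A s @^-1` B s)))).
  apply: eq_Ex => w; rewrite bigcap_seq; elim: (S) => [|s S' IH].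
    by rewrite !big_nil indicT.
  by rewrite !big_cons indicI /= IH.
rewrite Ex_indic; last by apply: bigcap_measurableType.
rewrite AI// (eq_bigr (fun s => (fine (P (A s @^-1` B s)))%:E)).
  by rewrite prodEFin.
by move=> s _; rewrite fineK// fin_num_measure.
Qed.

Lemma indep_future_sum t (I : Type) (r : seq I) (g : I -> T -> R) :
  (forall i, bdd_mfun (g i)) -> (forall i, indep_future t (g i)) ->
  indep_future t (fun w => \sum_(i <- r) g i w).
Proof.
move=> bg Ig S B uS tS mB; under eq_Ex do rewrite mulr_suml.
rewrite !Ex_sum//; last first.
  move=> i; apply: bdd_mfunM => //.
  by apply: bdd_mfun_prod => s; exact: bdd_indic.
by rewrite mulr_suml; apply: eq_bigr => i _; exact: Ig.
Qed.

Lemma mx_mfun_comp t m : mx_mfun m -> measurable_fun setT (fun w => m (A t w)).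
Proof.
by move=> mm _ Y mY; rewrite setTI; exact: (mA t _ (mm _ mY)).
Qed.

(** The factor [m (A t)] is split off by [Ex_mul_superlevel]: its superlevel sets are events on
    [A t], so the required factorization is the independence of [g] tested on the times [t :: S]. *)
Lemma indep_future_mul_prod t g m S B :
  bdd_mfun g -> indep_future t g -> mx_mfun m ->
  (forall w, 0 <= m (A t w) <= 1) ->
  uniq S -> (forall s, s \in S -> (t < s)%N) -> (forall s, mx_meas (B s)) ->
  Ex P (fun w => g w * m (A t w) * \prod_(s <- S) \1_(A s @^-1` B s) w) =
  Ex P g * Ex P (fun w => m (A t w)) *
    \prod_(s <- S) fine (P (A s @^-1` B s)).
Proof.
move=> bg Ig mm m01 uS tS mB.
have tNS : t \notin S by apply/negP => /tS; rewrite ltnn.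
have Ig0 := Ig S B uS (fun s sS => ltnW (tS s sS)) mB.
have bp : bdd_mfun (fun w => \prod_(s <- S) (\1_(A s @^-1` B s) w : R)).
  by apply: bdd_mfun_prod => s; exact: bdd_indic.
under eq_Ex do rewrite mulrAC.
rewrite (@Ex_mul_superlevel _ _ _ P _ (fun w => m (A t w))); first last.
- move=> c; pose C : set 'M[R]_N := m @^-1` `[c, +oo[%classic.
  have mC : mx_meas C by exact: mm.
  have -> : [set w | c <= m (A t w)] = A t @^-1` C.
    by apply/seteqP; split=> w; rewrite /C /= in_itv/= andbT.
  (* One family of events for [t :: S]: the superlevel set at time [t], the given events on [S],
     which does not contain [t]. *)
  pose B' s := if s == t then C else B s.
  have mB' s : mx_meas (B' s) by rewrite /B'; case: ifP.
  have B'B s : s \in S -> B' s = B s.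
    by rewrite /B'; case: eqP => // -> tS'; rewrite tS' in tNS.
  have := Ig (t :: S) B'.
  rewrite /= tNS uS => /(_ isT).
  have h s : s \in t :: S -> (t <= s)%N.
    by rewrite inE => /predU1P[->//|/tS/ltnW].
  move=> /(_ h mB'); rewrite big_cons {2}/B' eqxx.
  under [X in _ = _ * (_ * X)]eq_big_seq => s sS do rewrite B'B//.
  rewrite Ex_indic; last exact: mA.
  rewrite Ig0 mulrCA mulrC => <-; apply: eq_Ex => w.
  rewrite big_cons {1}/B' eqxx -mulrA [X in _ = _ * X]mulrC; congr (_ * (_ * _)).
  by apply: eq_big_seq => s sS; rewrite B'B.
- by [].
- exact: mx_mfun_comp.
- exact: bdd_mfunM.
by rewrite Ig0 mulrAC.
Qed.

Lemma Ex_indep_future t g m : bdd_mfun g -> indep_future t g -> mx_mfun m ->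
  (forall w, 0 <= m (A t w) <= 1) ->
  Ex P (fun w => g w * m (A t w)) = Ex P g * Ex P (fun w => m (A t w)).
Proof.
move=> bg Ig mm m01.
have := @indep_future_mul_prod t g m [::] (fun=> setT) bg Ig mm m01 isT.
rewrite big_nil mulr1 => <-//; last first.
  by move=> _; exact: (@measurableT _ (g_sigma_algebraType _)).
by apply: eq_Ex => w; rewrite big_nil mulr1.
Qed.

(** One time step: multiplying by a function of [A t] uses up time [t], leaving independence from
    the later matrices. *)
Lemma indep_futureM t g m : bdd_mfun g -> indep_future t g -> mx_mfun m ->
  (forall w, 0 <= m (A t w) <= 1) ->
  indep_future t.+1 (fun w => g w * m (A t w)).
Proof.
move=> bg Ig mm m01 S B uS tS mB.
by rewrite Ex_indep_future// indep_future_mul_prod.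
Qed.

End Independence.

(** * The energy and the quadratic forms of the Laplacian, for fixed matrices and vectors *)

Section Deterministic.
Context {R : realType} {N : nat}.

Definition energy (gamma : R) (y : 'cV[R]_N) : R :=
  (\sum_i y i 0) ^+ 2 + gamma * \sum_i y i 0 ^+ 2.

(** Products of two entries are the form in which independence can be applied to a random [y]. *)
Lemma energy_quad gamma (y : 'cV[R]_N) :
  energy gamma y = \sum_i \sum_j (1 + gamma * (i == j)%:R) * (y i 0 * y j 0).
Proof.
rewrite /energy expr2 mulr_suml mulr_sumr -big_split; apply: eq_bigr => i _ /=.
under [RHS]eq_bigr do rewrite mulrDl mul1r.
rewrite big_split /= mulr_sumr; congr (_ + _).
rewrite (bigD1 i)//= eqxx mulr1 big1 ?addr0// => j ji.
by rewrite eq_sym (negbTE ji) mulr0 mul0r.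
Qed.

Lemma sum_sqr_Var (y : 'cV[R]_N) : (0 < N)%N ->
  \sum_i y i 0 ^+ 2 = N%:R * (Var y + avg y ^+ 2).
Proof.
move=> N0; have Nn0 : N%:R != 0 :> R by rewrite pnatr_eq0 -lt0n.
rewrite /Var mulrDr mulrCA divff// mulr1.
have -> : \sum_i (y i 0 - avg y) ^+ 2 =
    \sum_i y i 0 ^+ 2 + (\sum_i y i 0) * (- 2 * avg y) + N%:R * avg y ^+ 2.
  have -> : N%:R * avg y ^+ 2 = \sum_(i < N) avg y ^+ 2.
    by rewrite sumr_const card_ord mulr_natl.
  rewrite mulr_suml -!big_split /=.
  by apply: eq_bigr => i _; ring.
have -> : \sum_i y i 0 = N%:R * avg y by rewrite /avg mulrCA divff// mulr1.
by ring.
Qed.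

Lemma Var_ge0 (y : 'cV[R]_N) : 0 <= Var y.
Proof. by rewrite divr_ge0//; apply: sumr_ge0 => i _; exact: sqr_ge0. Qed.

Lemma energy_avg gamma (y : 'cV[R]_N) : (0 < N)%N ->
  energy gamma y =
  N%:R * ((N%:R + gamma) * avg y ^+ 2 + gamma * Var y).
Proof.
move=> N0; have Nn0 : N%:R != 0 :> R by rewrite pnatr_eq0 -lt0n.
rewrite /energy sum_sqr_Var//.
have -> : \sum_i y i 0 = N%:R * avg y by rewrite /avg mulrCA divff// mulr1.
by ring.
Qed.

(** The matrix has rank at most one: with [L = 1 - M] the form is the square of the scalar
    [1^T L v]. *)
Lemma lap_sum_sqr (M : 'M[R]_N) (v : 'cV[R]_N) : row_stochastic M ->
  (v^T *m ((lap M)^T *m const_mx 1 *m (const_mx 1 : 'rV_N) *m lap M) *m v) 0 0 =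
  (\sum_i v i 0 - \sum_i (M *m v) i 0) ^+ 2.
Proof.
move=> SM; rewrite lap_row_stochastic//; set L := 1%:M - M.
have -> : v^T *m (L^T *m const_mx 1 *m (const_mx 1 : 'rV_N) *m L) *m v =
    (v^T *m L^T *m const_mx 1) *m ((const_mx 1 : 'rV_N) *m (L *m v)).
  by rewrite !mulmxA.
rewrite -trmx_mul -[const_mx 1 in X in X *m _]trmx_const -trmx_mul.
rewrite mxE big_ord1 mxE -expr2; congr (_ ^+ 2).
rewrite mxE -sumrB; apply: eq_bigr => i _.
by rewrite /L mulmxBl mul1mx !mxE mul1r.
Qed.

(** With [L = 1 - M] the cross terms cancel: [L + L^T - L^T L = 1 - M^T M]. *)
Lemma lap_dissipation (M : 'M[R]_N) (v : 'cV[R]_N) : row_stochastic M ->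
  (v^T *m (lap M + (lap M)^T - (lap M)^T *m lap M) *m v) 0 0 =
  \sum_i v i 0 ^+ 2 - \sum_i (M *m v) i 0 ^+ 2.
Proof.
move=> SM; rewrite lap_row_stochastic//.
have -> : 1%:M - M + (1%:M - M)^T - (1%:M - M)^T *m (1%:M - M) =
    1%:M - M^T *m M.
  rewrite linearB /= trmx1 mulmxBl !mulmxBr !mul1mx mulmx1.
  by apply/matrixP => i j; rewrite !mxE; ring.
rewrite mulmxBr mulmxBl mulmx1 !mulmxA -trmx_mul -mulmxA !mxE.
by congr (_ - _); apply: eq_bigr => i _; rewrite !mxE expr2.
Qed.

End Deterministic.

(** * One random step from a fixed vector *)

Section Step.
Context {R : realType} {N : nat} {d : measure_display} {T : measurableType d}.
Context (P : probability T R).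

Definition bdd_mx {m n} (F : T -> 'M[R]_(m, n)) : Prop :=
  forall i j, bdd_mfun (fun w => F w i j).

Lemma bdd_mx_cst {m n} (C : 'M[R]_(m, n)) : bdd_mx (fun=> C).
Proof. by move=> i j; exact: bdd_mfun_cst. Qed.

Lemma bdd_mx_tr {m n} (F : T -> 'M[R]_(m, n)) :
  bdd_mx F -> bdd_mx (fun w => (F w)^T).
Proof. by move=> bF i j; under eq_fun do rewrite mxE; exact: bF. Qed.

Lemma bdd_mxD {m n} (F G : T -> 'M[R]_(m, n)) :
  bdd_mx F -> bdd_mx G -> bdd_mx (fun w => F w + G w).
Proof. by move=> bF bG i j; under eq_fun do rewrite mxE; exact: bdd_mfunD. Qed.

Lemma bdd_mxB {m n} (F G : T -> 'M[R]_(m, n)) :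
  bdd_mx F -> bdd_mx G -> bdd_mx (fun w => F w - G w).
Proof. by move=> bF bG i j; under eq_fun do rewrite !mxE; exact: bdd_mfunB. Qed.

Lemma bdd_mxM {m n p} (F : T -> 'M[R]_(m, n)) (G : T -> 'M[R]_(n, p)) :
  bdd_mx F -> bdd_mx G -> bdd_mx (fun w => F w *m G w).
Proof.
move=> bF bG i j; under eq_fun do rewrite mxE.
by apply: bdd_mfun_sum => k; exact: bdd_mfunM.
Qed.

(** By linearity; it turns semidefiniteness of mean matrices into inequalities between scalar
    expectations. *)
Lemma Emx_quad (F : T -> 'M[R]_N) (v : 'cV[R]_N) : bdd_mx F ->
  (v^T *m Emx P F *m v) 0 0 = Ex P (fun w => (v^T *m F w *m v) 0 0).
Proof.
move=> bF.
have qE (M : 'M[R]_N) :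
    (v^T *m M *m v) 0 0 = \sum_j \sum_i (v i 0 * v j 0) * M i j.
  rewrite mxE; apply: eq_bigr => j _; rewrite mxE mulr_suml.
  by apply: eq_bigr => i _; rewrite !mxE; ring.
under eq_Ex do rewrite qE.
have b i j : bdd_mfun (fun w => v i 0 * v j 0 * F w i j).
  by apply: bdd_mfunM => //; exact: bdd_mfun_cst.
rewrite Ex_sum; last by move=> j; exact: bdd_mfun_sum.
rewrite qE; apply: eq_bigr => j _; rewrite Ex_sum//.
by apply: eq_bigr => i _; rewrite ExZ// mxE.
Qed.

Context (M : T -> 'M[R]_N) (gamma : R).
Context (mM : random_matrix M).
Context (SM : forall w, row_stochastic (M w)).

Lemma bdd_mx_stochastic : bdd_mx M.
Proof.
move=> i j; split.
  by move=> _ Y mY; rewrite setTI; exact: mM (mx_mfun_entry i j _ mY).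
exists 1 => w; have /andP[M0 M1] := row_stochastic_entry _ i j (SM w).
by rewrite ger0_norm.
Qed.

Lemma bdd_mx_lap : bdd_mx (fun w => lap (M w)).
Proof.
have -> : (fun w => lap (M w)) = (fun w => 1%:M - M w).
  by apply/funext => w; exact: lap_row_stochastic.
by apply: bdd_mxB bdd_mx_stochastic; exact: bdd_mx_cst.
Qed.

Context (centred : (const_mx 1 : 'rV[R]_N) *m Emx P (fun w => lap (M w)) = 0).

(** Entry [j] of [centred], with [lap M = 1 - M]: the mean matrix is doubly stochastic. *)
Lemma col_sum_Ex j : \sum_i Ex P (fun w => M w i j) = 1.
Proof.
have /matrixP/(_ 0 j) := centred; rewrite !mxE => E.
apply/eqP; rewrite eq_sym -subr_eq0; apply/eqP; rewrite -[RHS]E {E}.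
have E1 : 1 = \sum_i (i == j)%:R :> R.
  by rewrite (bigD1 j)//= eqxx big1 ?addr0// => i /negbTE ->.
rewrite [X in X - _ = _]E1 -sumrB; apply: eq_bigr => i _; rewrite !mxE mul1r.
rewrite -[fine _]/(Ex P (fun w => lap (M w) i j)).
rewrite (eq_Ex _ (fun w => lap (M w) i j) (fun w => (i == j)%:R - M w i j)).
  by rewrite ExB ?Ex_cst//; [exact: bdd_mfun_cst|exact: bdd_mx_stochastic].
by move=> w; rewrite lap_row_stochastic// !mxE.
Qed.

Lemma sum_Ex_mulmx (v : 'cV[R]_N) :
  Ex P (fun w => \sum_i (M w *m v) i 0) = \sum_i v i 0.
Proof.
have bM := bdd_mx_stochastic.
rewrite Ex_sum; last by move=> i; apply: bdd_mxM bM (bdd_mx_cst _) _ _.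
transitivity (\sum_i \sum_j v j 0 * Ex P (fun w => M w i j)).
  apply: eq_bigr => i _.
  under eq_Ex => w do [rewrite mxE; under eq_bigr do rewrite mulrC].
  rewrite Ex_sum; last by move=> k; exact: bdd_mfunM (bdd_mfun_cst _) _.
  by apply: eq_bigr => j _; rewrite ExZ.
rewrite exchange_big /=; apply: eq_bigr => j _.
by rewrite -mulr_sumr col_sum_Ex mulr1.
Qed.

Context (dissip :
  nsd (Emx P (fun w => (lap (M w))^T *m const_mx 1 *m
                         (const_mx 1 : 'rV[R]_N) *m lap (M w))
       - gamma *: Emx P (fun w => lap (M w) + (lap (M w))^T
                         - (lap (M w))^T *m lap (M w)))).

(** Testing [dissip] at [v] bounds the mean of [(s - S)^2] by [gamma] times the mean loss of squared
    norm, where [S] is the entry sum of [M v] and [s] that of [v]. Since [S] has mean [s], the left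
    side is the mean of [S^2] minus [s^2], and rearranging gives the claim. *)
Lemma Ex_energy_step (v : 'cV[R]_N) :
  Ex P (fun w => energy gamma (M w *m v)) <= energy gamma v.
Proof.
have bM := bdd_mx_stochastic; have bL := bdd_mx_lap.
have bMv i : bdd_mfun (fun w => (M w *m v) i 0).
  exact: bdd_mxM bM (bdd_mx_cst _) _ _.
have bS : bdd_mfun (fun w => \sum_i (M w *m v) i 0) by exact: bdd_mfun_sum.
have bQ : bdd_mfun (fun w => \sum_i (M w *m v) i 0 ^+ 2).
  by apply: bdd_mfun_sum => i; exact: bdd_mfunX.
have := dissip v.
rewrite mulmxBr mulmxBl -scalemxAr -scalemxAl.
have mxBZ (X Y : 'M[R]_1) : (X - gamma *: Y) 0 0 = X 0 0 - gamma * Y 0 0.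
  by rewrite !mxE.
rewrite mxBZ subr_le0.
rewrite [X in X <= _]Emx_quad; last first.
  do 3?apply: bdd_mxM => //; try exact: bdd_mx_cst.
  exact: bdd_mx_tr.
rewrite [X in _ <= gamma * X]Emx_quad; last first.
  apply: bdd_mxB; last by apply: bdd_mxM => //; exact: bdd_mx_tr.
  by apply: bdd_mxD => //; exact: bdd_mx_tr.
under eq_Ex do rewrite lap_sum_sqr//.
under [X in _ <= _ * X]eq_Ex do rewrite lap_dissipation//.
set s := \sum_i v i 0; set q := \sum_i v i 0 ^+ 2.
rewrite ExB//; last exact: bdd_mfun_cst.
rewrite Ex_cst.
have -> : Ex P (fun w => (s - \sum_i (M w *m v) i 0) ^+ 2) =
    Ex P (fun w => (\sum_i (M w *m v) i 0) ^+ 2) - s ^+ 2.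
  rewrite (eq_Ex _ _ (fun w => (\sum_i (M w *m v) i 0) ^+ 2 +
      (s ^+ 2 - (2 * s) * \sum_i (M w *m v) i 0))); last by move=> w; ring.
  have b1 : bdd_mfun (fun w => (2 * s) * \sum_i (M w *m v) i 0).
    exact: bdd_mfunM (bdd_mfun_cst _) _.
  rewrite ExD; [|exact: bdd_mfunX|exact: bdd_mfunB (bdd_mfun_cst _) _].
  rewrite ExB//; last exact: bdd_mfun_cst.
  by rewrite Ex_cst ExZ// sum_Ex_mulmx -/s; ring.
rewrite /energy ExD; [|exact: bdd_mfunX|exact: bdd_mfunM (bdd_mfun_cst _) _].
rewrite ExZ// -/s -/q.
by lra.
Qed.

End Step.

(** * The random process: moments, energy decay and the deviation bounds *)

Section Process.
Context {R : realType} {N : nat} {d : measure_display} {T : measurableType d}.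
Context (P : probability T R) (A : nat -> T -> 'M[R]_N) (x0 : 'cV[R]_N).
Context (mA : forall t, random_matrix (A t)).
Context (SA : forall t w, row_stochastic (A t w)).

Lemma procS t w : proc A x0 t.+1 w = A t w *m proc A x0 t w.
Proof. by rewrite /= lap_row_stochastic// mulmxBl mul1mx opprB addrC subrK. Qed.

Lemma proc_entryS t w i :
  proc A x0 t.+1 w i 0 = \sum_k proc A x0 t w k 0 * A t w i k.
Proof. by rewrite procS mxE; apply: eq_bigr => k _; rewrite mulrC. Qed.

Lemma proc_pairS t w i j :
  proc A x0 t.+1 w i 0 * proc A x0 t.+1 w j 0 =
  \sum_k \sum_l (proc A x0 t w k 0 * proc A x0 t w l 0) *
                (A t w i k * A t w j l).
Proof.
rewrite !proc_entryS mulr_suml; apply: eq_bigr => k _.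
by rewrite mulr_sumr; apply: eq_bigr => l _; ring.
Qed.

(** Each step takes convex combinations of entries, so the bound is uniform in [t] and [w]; this is
    what dominates the limit passage to consensus. *)
Lemma norm_proc_le t w i : `|proc A x0 t w i 0| <= \sum_k `|x0 k 0|.
Proof.
elim: t i => [|t IH] i.
  by rewrite /= (bigD1 i)//= lerDl; apply: sumr_ge0.
rewrite procS mxE; apply: le_trans (ler_norm_sum _ _ _) _.
rewrite -[leRHS]mul1r -(proj2 (SA t w) i) mulr_suml; apply: ler_sum => k _.
by rewrite normrM ger0_norm ?(proj1 (SA t w))// ler_wpM2l// (proj1 (SA t w)).
Qed.

Lemma bdd_mx_proc t : bdd_mx (fun w => proc A x0 t w).
Proof.
elim: t => [|t IH]; first exact: bdd_mx_cst.
under eq_fun do rewrite procS.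
by apply: bdd_mxM => //; exact: bdd_mx_stochastic.
Qed.

Let bdd_proc t i : bdd_mfun (fun w => proc A x0 t w i 0).
Proof. exact: bdd_mx_proc. Qed.

Let bdd_entry t i j : bdd_mfun (fun w => A t w i j).
Proof. exact: bdd_mx_stochastic. Qed.

Let entry01 t i j w : 0 <= A t w i j <= 1.
Proof. exact: row_stochastic_entry. Qed.

Let pair01 t i j k l w : 0 <= A t w i j * A t w k l <= 1.
Proof.
have /andP[a0 a1] := entry01 t i j w; have /andP[b0 b1] := entry01 t k l w.
by rewrite mulr_ge0//= mulr_ile1.
Qed.

Context (AI : mutually_independent P A).

(** The state at time [t] is built from [A 0], ..., [A (t - 1)] only; the recursion adds one factor
    [A t i k] per step. *)
Lemma indep_future_proc t i : indep_future P A t (fun w => proc A x0 t w i 0).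
Proof.
elim: t i => [|t IH] i; first exact: indep_future_cst.
under eq_fun do rewrite proc_entryS.
apply: indep_future_sum => // k; first exact: bdd_mfunM.
by apply: (indep_futureM _ _ mA _ _ (fun M => M i k)) => //; exact: mx_mfun_entry.
Qed.

(** The energy is quadratic, so products of two entries are needed; they obey a linear recursion of
    their own, [proc_pairS]. *)
Lemma indep_future_proc_pair t i j :
  indep_future P A t (fun w => proc A x0 t w i 0 * proc A x0 t w j 0).
Proof.
elim: t i j => [|t IH] i j; first by rewrite /=; exact: indep_future_cst.
under eq_fun do rewrite proc_pairS.
have b k l : bdd_mfun (fun w => proc A x0 t w k 0 * proc A x0 t w l 0 *
                                (A t w i k * A t w j l)).
  by do 2?apply: bdd_mfunM.
apply: indep_future_sum => // k; first exact: bdd_mfun_sum.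
apply: indep_future_sum => // l.
apply: (indep_futureM _ _ mA _ _ (fun M => M i k * M j l)) => //.
  exact: bdd_mfunM.
by apply: mx_mfunM; exact: mx_mfun_entry.
Qed.

Lemma Ex_procS t i : Ex P (fun w => proc A x0 t.+1 w i 0) =
  \sum_k Ex P (fun w => proc A x0 t w k 0) * Ex P (fun w => A t w i k).
Proof.
under eq_Ex do rewrite proc_entryS.
rewrite Ex_sum => [|k]; last exact: bdd_mfunM.
apply: eq_bigr => k _.
rewrite (Ex_indep_future _ _ mA t _ (fun M => M i k))//.
- exact: indep_future_proc.
- exact: mx_mfun_entry.
Qed.

Lemma Ex_proc_pairS t i j :
  Ex P (fun w => proc A x0 t.+1 w i 0 * proc A x0 t.+1 w j 0) =
  \sum_k \sum_l Ex P (fun w => proc A x0 t w k 0 * proc A x0 t w l 0) *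
                Ex P (fun w => A t w i k * A t w j l).
Proof.
under eq_Ex do rewrite proc_pairS.
have b k l : bdd_mfun (fun w => proc A x0 t w k 0 * proc A x0 t w l 0 *
                                (A t w i k * A t w j l)).
  by do 2?apply: bdd_mfunM.
rewrite Ex_sum => [|k]; last exact: bdd_mfun_sum.
apply: eq_bigr => k _; rewrite Ex_sum//; apply: eq_bigr => l _.
rewrite (Ex_indep_future _ _ mA t _ (fun M => M i k * M j l))//.
- exact: bdd_mfunM.
- exact: indep_future_proc_pair.
- by apply: mx_mfunM; exact: mx_mfun_entry.
Qed.

Lemma Ex_energy (F : T -> 'cV[R]_N) gamma : bdd_mx F ->
  Ex P (fun w => energy gamma (F w)) =
  \sum_i \sum_j (1 + gamma * (i == j)%:R) * Ex P (fun w => F w i 0 * F w j 0).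
Proof.
move=> bF; under eq_Ex do rewrite energy_quad.
have b (i j : 'I_N) : bdd_mfun (fun w => (1 + gamma * (i == j)%:R) * (F w i 0 * F w j 0)).
  by apply: bdd_mfunM (bdd_mfun_cst _) _; exact: bdd_mfunM.
rewrite Ex_sum => [|k]; last exact: bdd_mfun_sum.
apply: eq_bigr => k _; rewrite Ex_sum//; apply: eq_bigr => l _.
by rewrite ExZ//; exact: bdd_mfunM.
Qed.

Context (centred :
  forall t, (const_mx 1 : 'rV[R]_N) *m Emx P (fun w => lap (A t w)) = 0).

(** Conserved because the columns of the mean of [A t] sum to 1 and [A t] is independent of the
    state. *)
Lemma Ex_sum_proc t : Ex P (fun w => \sum_i proc A x0 t w i 0) = \sum_i x0 i 0.
Proof.
elim: t => [|t IH]; first by rewrite /= Ex_cst.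
rewrite -{}IH !Ex_sum//; under eq_bigr do rewrite Ex_procS.
rewrite exchange_big; apply: eq_bigr => k _ /=.
by rewrite -mulr_sumr col_sum_Ex// mulr1.
Qed.

Context (gamma : R).
Context (dissip : forall t,
  nsd (Emx P (fun w => (lap (A t w))^T *m const_mx 1 *m
                         (const_mx 1 : 'rV[R]_N) *m lap (A t w))
       - gamma *: Emx P (fun w => lap (A t w) + (lap (A t w))^T
                         - (lap (A t w))^T *m lap (A t w)))).

(* Averaging over [A t] turns the energy of [A t *m y] into a fixed quadratic
   form [K] in [y], dominated by the energy of [y] for every [y]; independence
   allows to apply this with [y] the random state at time [t]. *)
Lemma Ex_energy_procS t :
  Ex P (fun w => energy gamma (proc A x0 t.+1 w)) <=
  Ex P (fun w => energy gamma (proc A x0 t w)).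
Proof.
pose K k l : R := \sum_i \sum_j (1 + gamma * (i == j)%:R) *
  Ex P (fun w => A t w i k * A t w j l).
have KE (v : 'cV[R]_N) : Ex P (fun w => energy gamma (A t w *m v)) =
    \sum_k \sum_l K k l * (v k 0 * v l 0).
  rewrite Ex_energy; last first.
    by apply: bdd_mxM (bdd_mx_cst _); exact: bdd_mx_stochastic.
  transitivity (\sum_i \sum_j \sum_k \sum_l (1 + gamma * (i == j)%:R) *
      Ex P (fun w => A t w i k * A t w j l) * (v k 0 * v l 0)).
    apply: eq_bigr => i _; apply: eq_bigr => j _.
    have b k l : bdd_mfun (fun w => v k 0 * v l 0 * (A t w i k * A t w j l)).
      by apply: bdd_mfunM (bdd_mfun_cst _) _; exact: bdd_mfunM.
    rewrite (eq_Ex _ _ (fun w => \sum_k \sum_l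
        v k 0 * v l 0 * (A t w i k * A t w j l))); last first.
      move=> w; rewrite !mxE mulr_suml; apply: eq_bigr => k _.
      by rewrite mulr_sumr; apply: eq_bigr => l _; ring.
    rewrite Ex_sum => [|k]; last exact: bdd_mfun_sum.
    rewrite mulr_sumr; apply: eq_bigr => k _.
    rewrite Ex_sum// mulr_sumr; apply: eq_bigr => l _.
    by rewrite ExZ; [ring | exact: bdd_mfunM].
  (* The state indices [k], [l] are moved outside the sums over [i], [j], which then collapse to
     [K k l]. *)
  under eq_bigr do rewrite exchange_big; rewrite exchange_big /=.
  apply: eq_bigr => k _.
  under eq_bigr do rewrite exchange_big; rewrite exchange_big /=.
  apply: eq_bigr => l _; rewrite mulr_suml; apply: eq_bigr => i _.
  by rewrite mulr_suml.
have bp k l : bdd_mfun (fun w => proc A x0 t w k 0 * proc A x0 t w l 0).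
  exact: bdd_mfunM.
have bKp k l : bdd_mfun (fun w => K k l * (proc A x0 t w k 0 * proc A x0 t w l 0)).
  exact: bdd_mfunM (bdd_mfun_cst _) _.
(* The computation of [KE] with a random state: independence splits each mean of [x_k x_l a_ik a_jl]
   into two factors. *)
have -> : Ex P (fun w => energy gamma (proc A x0 t.+1 w)) =
    Ex P (fun w => \sum_k \sum_l K k l * (proc A x0 t w k 0 * proc A x0 t w l 0)).
  rewrite Ex_energy; last exact: bdd_mx_proc.
  rewrite Ex_sum => [|k]; last exact: bdd_mfun_sum.
  transitivity (\sum_i \sum_j \sum_k \sum_l (1 + gamma * (i == j)%:R) *
      (Ex P (fun w => proc A x0 t w k 0 * proc A x0 t w l 0) *
       Ex P (fun w => A t w i k * A t w j l))).
    apply: eq_bigr => i _; apply: eq_bigr => j _.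
    rewrite Ex_proc_pairS mulr_sumr; apply: eq_bigr => k _.
    by rewrite mulr_sumr.
  under eq_bigr do rewrite exchange_big; rewrite exchange_big /=.
  apply: eq_bigr => k _.
  under eq_bigr do rewrite exchange_big; rewrite exchange_big /=.
  rewrite Ex_sum//; apply: eq_bigr => l _.
  rewrite ExZ// mulr_suml; apply: eq_bigr => i _.
  by rewrite mulr_suml; apply: eq_bigr => j _; ring.
apply: le_Ex.
- by apply: bdd_mfun_sum => k; exact: bdd_mfun_sum.
- under eq_fun do rewrite energy_quad.
  do 2 apply: bdd_mfun_sum => ?.
  exact: bdd_mfunM (bdd_mfun_cst _) _.
(* For each [w], the state [proc A x0 t w] serves as the fixed vector [v]. *)
- by move=> w; rewrite -KE; exact: Ex_energy_step.
Qed.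

Lemma Ex_energy_proc_le t :
  Ex P (fun w => energy gamma (proc A x0 t w)) <= energy gamma x0.
Proof.
elim: t => [|t]; first by rewrite /= Ex_cst.
exact: le_trans (Ex_energy_procS t).
Qed.

Context (N0 : (0 < N)%N) (gamma0 : 0 < gamma).

Lemma bdd_avg_proc t : bdd_mfun (fun w => avg (proc A x0 t w)).
Proof. by apply: bdd_mfunM (bdd_mfun_cst _); exact: bdd_mfun_sum. Qed.

Lemma Ex_avg_proc t : Ex P (fun w => avg (proc A x0 t w)) = avg x0.
Proof.
under eq_Ex do rewrite /avg mulrC.
by rewrite ExZ ?Ex_sum_proc 1?mulrC//; exact: bdd_mfun_sum.
Qed.

Lemma Ex_avg_deviation t :
  Ex P (fun w => (avg (proc A x0 t w) - avg x0) ^+ 2) <=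
  gamma / (N%:R + gamma) * Var x0.
Proof.
have N0r : 0 < N%:R :> R by rewrite ltr0n.
have Ng : 0 < N%:R + gamma by exact: addr_gt0.
have ba := bdd_avg_proc t; set a := fun w => avg (proc A x0 t w) in ba *.
have ba2 : bdd_mfun (fun w => a w ^+ 2) by exact: bdd_mfunX.
(* Variance formula, valid because [a] has mean [avg x0]. *)
have -> : Ex P (fun w => (a w - avg x0) ^+ 2) =
    Ex P (fun w => a w ^+ 2) - avg x0 ^+ 2.
  rewrite (eq_Ex _ _ (fun w => a w ^+ 2 + (avg x0 ^+ 2 - 2 * avg x0 * a w)));
    last by move=> w; ring.
  have b1 : bdd_mfun (fun w => 2 * avg x0 * a w).
    exact: bdd_mfunM (bdd_mfun_cst _) _.
  rewrite ExD//; last exact: bdd_mfunB (bdd_mfun_cst _) _.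
  rewrite ExB//; last exact: bdd_mfun_cst.
  by rewrite Ex_cst ExZ// Ex_avg_proc; ring.
(* Energy decay, after dropping the nonnegative variance term of [energy_avg] at time [t]. *)
have : N%:R * (N%:R + gamma) * Ex P (fun w => a w ^+ 2) <= energy gamma x0.
  apply: le_trans (Ex_energy_proc_le t); rewrite -ExZ//; apply: le_Ex.
  - exact: bdd_mfunM (bdd_mfun_cst _) _.
  - under eq_fun do rewrite energy_quad.
    do 2 apply: bdd_mfun_sum => ?.
    by apply: bdd_mfunM (bdd_mfun_cst _) _; exact: bdd_mfunM.
  - move=> w; rewrite energy_avg// -mulrA ler_pM2l// lerDl.
    by rewrite mulr_ge0 ?Var_ge0// ltW.
rewrite energy_avg// -mulrA ler_pM2l// => h.
rewrite mulrAC ler_pdivlMr// mulrBl mulrC [X in _ - X]mulrC.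
by lra.
Qed.

Lemma avg_deviation t :
  (\int[P]_w ((avg (proc A x0 t w) - avg x0) ^+ 2)%:E <=
   (gamma / (N%:R + gamma) * Var x0)%:E)%E.
Proof.
rewrite ExE ?lee_fin; first exact: Ex_avg_deviation.
by apply: bdd_mfunX; apply: bdd_mfunB (bdd_avg_proc t) (bdd_mfun_cst _).
Qed.

Lemma consensus_deviation (xinf : T -> R) : measurable_fun setT xinf ->
  {ae P, forall w, forall i : 'I_N,
     (fun t => proc A x0 t w i 0) @ \oo --> xinf w} ->
  (\int[P]_w ((xinf w - avg x0) ^+ 2)%:E <=
   (gamma / (N%:R + gamma) * Var x0)%:E)%E.
Proof.
move=> mx cx; pose C : R := \sum_k `|x0 k 0|.
have N0r : 0 < N%:R :> R by rewrite ltr0n.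
have avgC t w : `|avg (proc A x0 t w)| <= C.
  rewrite /avg normrM normfV (gtr0_norm N0r) ler_pdivrMr//.
  apply: le_trans (ler_norm_sum _ _ _) _; rewrite mulr_natr.
  apply: (@le_trans _ _ (\sum_(i < N) C)); last by rewrite sumr_const card_ord.
  by apply: ler_sum => i _; exact: norm_proc_le.
(* Dominated convergence for the squared deviations; both averages are at most [C] in absolute
   value, whence the constant [(C + C) ^+ 2]. *)
pose f t w := (((avg (proc A x0 t w) - avg x0) ^+ 2)%:E : \bar R).
have [] := @dominated_convergence _ _ _ P setT measurableT f
  (fun w => ((xinf w - avg x0) ^+ 2)%:E) (fun=> ((C + C) ^+ 2)%:E).
- move=> t; apply/measurable_EFinP; apply: measurable_funX.
  by apply: measurable_funB => //; exact: (bdd_avg_proc t).1.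
- apply/measurable_EFinP; apply: measurable_funX.
  exact: measurable_funB.
- apply: filterS cx => w cw _; apply: cvg_EFin; first by near=> t.
  rewrite /f /comp /=; apply: (@cvg_comp _ _ _ _ (fun x => x ^+ 2)); last first.
    exact: exprn_continuous.
  apply: cvgB; last exact: cvg_cst.
  (* The limit is written as an average of [N] copies, so that convergence of the averages follows
     entrywise. *)
  have -> : xinf w = (\sum_(i < N) xinf w) / N%:R.
    by rewrite sumr_const card_ord -[X in X / _]mulr_natr mulfK// gt_eqF.
  apply: cvgM; last exact: cvg_cst.
  by apply: cvg_big => [|i _]; [exact: add_continuous | exact: cw].
- exact: bdd_mfun_integrable (bdd_mfun_cst _).
- apply: aeW => w t _; rewrite /f /= lee_fin normrX.
  have C0 : 0 <= C by apply: sumr_ge0.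
  rewrite ler_pXn2r ?nnegrE ?addr_ge0//.
  apply: le_trans (ler_normB _ _) _; apply: lerD => //.
  exact: (avgC 0%N w).
(* The bound at each finite time does not depend on [t], so it passes to the limit of the
   integrals. *)
move=> _ _ /cvge_to_le; apply; near=> t; exact: avg_deviation.
Unshelve. all: by end_near.
Qed.

End Process.

Theorem theorem1 (R : realType) (N : nat) (d : measure_display)
  (T : measurableType d) (P : probability T R)
  (A : nat -> T -> 'M[R]_N) (x0 : 'cV[R]_N) (gamma : R) :
  (0 < N)%N ->
  (forall t, random_matrix (A t)) ->
  (forall t w, row_stochastic (A t w)) ->
  mutually_independent P A ->
  identically_distributed P A ->
  (forall t, (const_mx 1 : 'rV[R]_N) *m Emx P (fun w => lap (A t w)) = 0) ->
  0 < gamma ->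
  (forall t, nsd (Emx P (fun w => (lap (A t w))^T *m const_mx 1 *m
                                    (const_mx 1 : 'rV[R]_N) *m lap (A t w))
                 - gamma *: Emx P (fun w => lap (A t w) + (lap (A t w))^T
                                    - (lap (A t w))^T *m lap (A t w)))) ->
  (forall t : nat,
     (\int[P]_w ((avg (proc A x0 t w) - avg x0) ^+ 2)%:E <=
      (gamma / (N%:R + gamma) * Var x0)%:E)%E) /\
  (forall xinf : T -> R, measurable_fun setT xinf ->
     {ae P, forall w, forall i : 'I_N,
        (fun t => proc A x0 t w i 0) @ \oo --> xinf w} ->
     (\int[P]_w ((xinf w - avg x0) ^+ 2)%:E <=
      (gamma / (N%:R + gamma) * Var x0)%:E)%E).
Proof.
move=> N0 mA SA AI _ cA g0 dA; split=> [t|xinf mx cx].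
  exact: avg_deviation.
exact: consensus_deviation.
Qed.
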